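(* Let $X$ be a Hausdorff topological vector space over $\mathbb{R}$ or $\mathbb{C}$, $A\subset X$ a convex set, $H$ a nonempty set of functions $X\to\overline{\mathbb{R}}$ closed under vertical shifts (i.e. $h+c\in H$ for all $h\in H$, $c\in\mathbb{R}$), and $f_i\colon X\to\mathbb{R}$, $i\in I_0=\{0\}\cup I$, $I=\{1,\ldots,n\}$. Let the functions $f_i$, $i\in I_0$, be weakly $H$-codifferentiable at a point $x^*\in A$, and let $x^*$ be a point of local minimum of the problem $$f_0(x)\to\inf,\quad x\in A,\quad f_i(x)\le0,\quad i\in I.$$ Suppose that $H$ is closed under addition and that $0\in\operatorname{int}\operatorname{dom}h$ for every $h\in H$. Then for any $(\Phi_i,\Psi_i)\in\delta(f_i)_H[x^*]$ and $p_i\in\overline{\partial}_H\Psi_i(0)$, $i\in I_0$, such that the $H$-convex function $$g(\cdot)=\sup\{\Phi_0(\cdot)+p_0(\cdot),\ \Phi_1(\cdot)+p_1(\cdot)+f_1(x^* ),\ldots,\Phi_n(\cdot)+p_n(\cdot)+f_n(x^* )\}$$ is subhomogeneous, the function $g$ attains a global minimum on the set $A-x^*$ at the origin.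
   Context: $\overline{\mathbb{R}}=\mathbb{R}\cup\{\pm\infty\}$ with $x+(\pm\infty)=\pm\infty$ for real $x$; expressions $+\infty+(-\infty)$ are not considered, i.e. all sums appearing are understood to be well defined. For $f\colon X\to\overline{\mathbb{R}}$, $\operatorname{dom}f=\{x: f(x)\in\mathbb{R}\}$. $H$ is closed under addition if for any $h_1,h_2\in H$ the sum $h_1+h_2$ is well defined and belongs to $H$. A function $X\to\overline{\mathbb{R}}$ is $H$-convex (resp. $H$-concave) if it is the pointwise supremum (resp. infimum) of a nonempty subset of $H$. $A-x^*=\{a-x^*\mid a\in A\}$. A function $f\colon X\to\mathbb{R}$ is weakly $H$-codifferentiable at $x$ if there is a pair $(\Phi,\Psi)$, with $\Phi\colon X\to\overline{\mathbb{R}}$ $H$-convex, $\Psi\colon X\to\overline{\mathbb{R}}$ $H$-concave and $\operatorname{dom}\Phi\cap\operatorname{dom}\Psi$ containing a neighbourhood of $0$, such that $\Phi(0)+\Psi(0)=0$ and for every $\Delta x\in X$ with $\operatorname{co}\{0,\Delta x\}\subset\operatorname{dom}\Phi\cap\operatorname{dom}\Psi$ one has $f(x+\Delta x)-f(x)=\Phi(\Delta x)+\Psi(\Delta x)+o(\Delta x,x)$, where $o(\alpha\Delta x,x)/\alpha\to0$ as $\alpha\downarrow0$. The weak $H$-derivative $\delta f_H[x]$ is the set (equivalence class) of all such pairs. $\overline{\partial}_H\Psi(0)=\{p\in H\mid p\ge\Psi\text{ on }X,\ p(0)=\Psi(0)\}$ is the $H$-superdifferential of $\Psi$ at $0$.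 A function $f\colon X\to\overline{\mathbb{R}}$ with $f(0)=0$ is subhomogeneous if $f(\alpha\Delta x)\le\alpha f(\Delta x)$ for all $\Delta x\in X$, $\alpha\in(0,1)$. *)

(* Defs.v *)
From HB Require Import structures.
From mathcomp Require Import all_boot all_order all_algebra.
From mathcomp Require Import all_classical all_reals all_analysis.
From mathcomp Require Import complex.

Set Implicit Arguments.
Unset Strict Implicit.
Unset Printing Implicit Defensive.

Import Order.TTheory GRing.Theory Num.Theory.
Import numFieldNormedType.Exports.

Local Open Scope classical_set_scope.
Local Open Scope ring_scope.

Inductive scalars := RealScalars | ComplexScalars.

Definition scalar_field (R : realType) (F : scalars) : numFieldType :=
  match F with
  | RealScalars => R
  | ComplexScalars => R[i]
  end.

Definition real_scalar (R : realType) (F : scalars) : R -> scalar_field R F :=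
  match F with
  | RealScalars => fun t => t
  | ComplexScalars => fun t => t%:C%C
  end.

Arguments real_scalar {R F} t.

(* The weights of [convex_set] are the [t : K] with [0 <= t <= 1]; for
   [K = R[i]] the order is partial and these are exactly the reals of [0, 1],
   so this is real convexity over both scalar fields. *)
Definition convex_hull (K : numDomainType) (X : lmodType K) (S : set X) :
    set X :=
  \bigcap_(C in [set C : set X | convex_set C /\ S `<=` C]) C.

Definition edom (R : realType) (X : Type) (h : X -> \bar R) : set X :=
  [set x | h x \is a fin_num].

Definition closed_under_shifts (R : realType) (X : Type)
    (H : set (X -> \bar R)) : Prop :=
  forall (h : X -> \bar R) (c : R), H h -> H (fun x => h x + c%:E)%E.

(* [a +? b] excludes the sums of [+oo] and [-oo]. *)
Definition closed_under_addition (R : realType) (X : Type)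
    (H : set (X -> \bar R)) : Prop :=
  forall h1 h2 : X -> \bar R, H h1 -> H h2 ->
    (forall x, (h1 x +? h2 x)%E) /\ H (fun x => h1 x + h2 x)%E.

Definition Hconvex (R : realType) (X : Type) (H : set (X -> \bar R))
    (phi : X -> \bar R) : Prop :=
  exists S : set (X -> \bar R), [/\ S !=set0, S `<=` H &
    forall x, phi x = ereal_sup [set h x | h in S]].

Definition Hconcave (R : realType) (X : Type) (H : set (X -> \bar R))
    (psi : X -> \bar R) : Prop :=
  exists S : set (X -> \bar R), [/\ S !=set0, S `<=` H &
    forall x, psi x = ereal_inf [set h x | h in S]].

Definition weak_Hcodifferential (R : realType) (F : scalars)
    (X : topologicalLmodType (scalar_field R F)) (H : set (X -> \bar R))
    (f : X -> R) (x : X) (phi psi : X -> \bar R) : Prop :=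
  [/\ Hconvex H phi, Hconcave H psi,
      nbhs (0 : X) (edom phi `&` edom psi),
      (phi 0%R + psi 0%R = 0)%E &
      exists o : X -> R, forall dx : X,
        convex_hull [set 0; dx] `<=` edom phi `&` edom psi ->
        (f (x + dx) - f x)%:E = (phi dx + psi dx + (o dx)%:E)%E /\
        (fun a : R => o (real_scalar a *: dx) / a) @ 0^'+ --> (0 : R)].

Definition weak_Hderivative (R : realType) (F : scalars)
    (X : topologicalLmodType (scalar_field R F)) (H : set (X -> \bar R))
    (f : X -> R) (x : X) : set ((X -> \bar R) * (X -> \bar R)) :=
  [set c | weak_Hcodifferential H f x c.1 c.2].

Definition weakly_Hcodifferentiable (R : realType) (F : scalars)
    (X : topologicalLmodType (scalar_field R F)) (H : set (X -> \bar R))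
    (f : X -> R) (x : X) : Prop :=
  weak_Hderivative H f x !=set0.

Definition Hsuperdifferential0 (R : realType) (X : nmodType)
    (H : set (X -> \bar R)) (psi : X -> \bar R) : set (X -> \bar R) :=
  [set p | [/\ H p, forall x, (psi x <= p x)%E & p 0 = psi 0]].

Definition subhomogeneous (R : realType) (F : scalars)
    (X : lmodType (scalar_field R F)) (g : X -> \bar R) : Prop :=
  g 0 = 0%E /\
  forall (dx : X) (a : R), 0 < a < 1 ->
    (g (real_scalar a *: dx) <= a%:E * g dx)%E.

(* [f ord0] is the objective and [f (lift ord0 i)], [i : 'I_n], are the
   functions of the inequality constraints. *)
Definition feasible_set (R : realType) (X : Type) (n : nat) (A : set X)
    (f : 'I_n.+1 -> X -> R) : set X :=
  [set x | A x /\ forall i : 'I_n, f (lift ord0 i) x <= 0].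

Definition local_min_on (R : realType) (X : topologicalType) (S : set X)
    (f : X -> R) (x : X) : Prop :=
  S x /\ \forall y \near x, S y -> f x <= f y.

Definition global_min_on (R : realType) (X : Type) (S : set X)
    (g : X -> \bar R) (x : X) : Prop :=
  S x /\ forall y, S y -> (g x <= g y)%E.

Definition gfun (R : realType) (X : Type) (n : nat) (f : 'I_n.+1 -> X -> R)
    (xs : X) (phi p : 'I_n.+1 -> X -> \bar R) : X -> \bar R :=
  fun dx => ereal_sup
    ([set (phi ord0 dx + p ord0 dx)%E] `|`
     range (fun i : 'I_n => (phi (lift ord0 i) dx + p (lift ord0 i) dx
                             + (f (lift ord0 i) xs)%:E)%E)).

(* Main.v *)
Require Import Defs.
From HB Require Import structures.
From mathcomp Require Import all_boot all_order all_algebra.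
From mathcomp Require Import all_classical all_reals all_analysis.
From mathcomp Require Import complex lra.

(** If [g v < 0] with [xs + v] in [A], replace [v] by [d v] with [d > 0] small
    enough that the segment from [0] to [d v] lies in all the domains.
    Subhomogeneity gives [g (a d v) <= a d g v] for [a] in ]0, 1[, while
    [psi_i <= p_i] and the codifferential expansion give
    [f_i (xs + a d v) <= g (a d v) + o(a)], and the same bound for
    [f_0 (xs + a d v) - f_0 xs].
    For small [a > 0] the linear term [a d g v < 0] dominates [o(a)], so
    [xs + a d v] is feasible (as [A] is convex) and strictly better than [xs],
    contradicting local minimality. *)

Set Implicit Arguments.
Unset Strict Implicit.
Unset Printing Implicit Defensive.

Import Order.TTheory GRing.Theory Num.Theory.
Import numFieldNormedType.Exports.

Local Open Scope classical_set_scope.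
Local Open Scope ring_scope.

Section real_scalar.
Context {R : realType} {F : scalars}.
Implicit Types a b : R.
Let rs a : scalar_field R F := real_scalar a.

Lemma real_scalar0 : rs 0 = 0.
Proof. by rewrite /rs; case: F. Qed.

Lemma real_scalar1 : rs 1 = 1.
Proof. by rewrite /rs; case: F. Qed.

Lemma real_scalarD a b : rs (a + b) = rs a + rs b.
Proof. by rewrite /rs; case: F => //=; rewrite rmorphD. Qed.

Lemma real_scalarM a b : rs (a * b) = rs a * rs b.
Proof. by rewrite /rs; case: F => //=; rewrite rmorphM. Qed.

Lemma ler_real_scalar a b : (rs a <= rs b) = (a <= b).
Proof. by rewrite /rs; case: F => //=; rewrite lecR. Qed.

Lemma real_scalar_norm a : `|rs a| = rs `|a|.
Proof.
rewrite /rs; case: F => //=.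
by rewrite normc_def /= expr0n addr0 sqrtr_sqr.
Qed.

(** Over [R[i]], [0 <= k] forces the imaginary part of [k] to vanish. This turns radii and convexity
    weights of the scalar field into reals. *)
Lemma real_scalar_ge0P (k : scalar_field R F) :
  0 <= k -> exists2 a, 0 <= a & k = rs a.
Proof.
rewrite /rs; case: F k => /= k k0; first by exists k.
move: k k0 => [x y]; rewrite lecE /= => /andP[/eqP -> x0].
by exists x.
Qed.

Lemma real_scalar_cvg0 : rs a @[a --> 0] --> (0 : (scalar_field R F)^o).
Proof.
apply/cvgrPdist_lt => e e0.
have [d d_ge0 ed] := real_scalar_ge0P (ltW e0).
have d0 : 0 < d.
  rewrite lt_neqAle d_ge0 andbT eq_sym; apply: contraTneq e0 => d0.
  by rewrite ed d0 real_scalar0 ltxx.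
near=> a; rewrite sub0r normrN real_scalar_norm ed.
rewrite lt_neqAle ler_real_scalar.
have ad : `|a| < d by near: a; exact: (@nbhs0_lt R R^o).
rewrite (ltW ad) andbT; apply: contraTneq ad => /eqP.
by rewrite eq_le !ler_real_scalar -eq_le => /eqP ->; rewrite ltxx.
Unshelve. all: by end_near. Qed.

(** Continuity of scaling at [(0, v)] replaces norm estimates: small real multiples of [v] enter any
    neighbourhood of the origin. *)
Lemma real_scale_cvg0 (X : topologicalLmodType (scalar_field R F)) (v : X) :
  rs a *: v @[a --> 0] --> (0 : X).
Proof.
rewrite -[X in _ --> X](scale0r v).
apply: (@continuous2_cvg _ _ _ _ _ _ (fun a => rs a : (scalar_field R F)^o)
  (fun=> v) (fun k w => k *: w)).
- exact: (@scale_continuous _ X (0, v)).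
- exact: real_scalar_cvg0.
- exact: cvg_cst.
Qed.

Lemma convex_set_real_scale (X : lmodType (scalar_field R F)) (A : set X)
    x v a :
  convex_set A -> A x -> A (x + v) -> 0 <= a <= 1 -> A (x + rs a *: v).
Proof.
move=> cA Ax Axv /andP[a0 a1].
have ra0 : 0 <= rs a by rewrite -real_scalar0 ler_real_scalar.
have ra1 : rs a <= 1 by rewrite -real_scalar1 ler_real_scalar.
have := cA (x + v) x (Itv01 ra0 ra1) (mem_set Axv) (mem_set Ax).
move/set_mem; rewrite /conv/=.
suff -> : rs a *: (x + v) + (1 - rs a) *: x = x + rs a *: v by [].
by rewrite scalerDr scalerBl scale1r addrCA [_ *: x + _]addrC addrK.
Qed.

(** The segment of real multiples of [v] is itself convex and contains [0] and [v], so the hull lies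
    inside it. *)
Lemma convex_hull_real_scale (X : lmodType (scalar_field R F)) (N : set X) v :
  (forall a, 0 <= a <= 1 -> N (rs a *: v)) -> convex_hull [set 0; v] `<=` N.
Proof.
move=> Nv x /(_ [set rs a *: v | a in [set a | 0 <= a <= 1]]) [].
  split; last first.
    move=> _ [->|->].
      by exists 0; rewrite /= ?lexx ?ler01// real_scalar0 scale0r.
    by exists 1; rewrite /= ?lexx ?ler01// real_scalar1 scale1r.
  move=> y z k /set_mem[a /andP[a0 a1] <-] /set_mem[b /andP[b0 b1] <-].
  have [c c0 kc] := real_scalar_ge0P (ge0 k).
  have c1 : c <= 1 by rewrite -ler_real_scalar -kc real_scalar1 le1.
  apply/mem_set; exists (c * a + (1 - c) * b); first by rewrite /=; nra.
  rewrite /conv/= kc real_scalarD !real_scalarM scalerDl !scalerA.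
  congr (_ + (_ * _) *: _); apply/eqP.
  by rewrite eq_sym subr_eq -real_scalarD subrK real_scalar1.
by move=> a a01 <-; exact: Nv.
Qed.

End real_scalar.

(** Since [psi <= p], the increment of [f] plus [e] is at most [a * c + o(a)], which is negative for
    small [a]. The offset [e] lets one statement serve the objective ([e = 0]) and the constraints
    ([e] the value at [x]). *)
Lemma weak_Hcodifferential_descent (R : realType) (F : scalars)
    (X : topologicalLmodType (scalar_field R F)) (H : set (X -> \bar R))
    (f : X -> R) (x v : X) (phi psi p : X -> \bar R) (e c : R) :
  weak_Hcodifferential H f x phi psi -> (forall dx, psi dx <= p dx)%E ->
  (forall a : R, 0 <= a <= 1 -> (edom phi `&` edom psi) (real_scalar a *: v)) ->
  c < 0 ->
  (forall a : R, 0 < a < 1 ->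
    (phi (real_scalar a *: v)%R + p (real_scalar a *: v)%R + e%:E
      <= (a * c)%:E)%E) ->
  \forall a \near 0^'+, f (x + real_scalar a *: v) - f x + e < 0.
Proof.
move=> [_ _ _ _ [rem frem]] psip domv c0 gc.
have [_ /cvgrPdist_lt/(_ (- c))] := frem _ (convex_hull_real_scale domv).
rewrite oppr_gt0 => /(_ c0) ov.
near=> a.
have a0 : 0 < a by near: a; exact: nbhs_right_gt.
have a1 : a < 1 by near: a; exact: nbhs_right_lt.
have oa : rem (real_scalar a *: v) < - c * a.
  rewrite -ltr_pdivrMr//; apply: le_lt_trans (ler_norm _) _.
  by rewrite -normrN -[- _]add0r; near: a.
(* The expansion at [v] only supplies the limit of the remainder; the increment itself needs the
   expansion at [a v], hence the segment up to [a v]. *)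
have domav b : 0 <= b <= 1 ->
    (edom phi `&` edom psi) (real_scalar b *: (real_scalar a *: v)).
  move=> b01; rewrite scalerA -real_scalarM; apply: domv; nra.
have [fE _] := frem _ (convex_hull_real_scale domav).
have [] : (edom phi `&` edom psi) (real_scalar a *: v).
  by apply: domv; rewrite !ltW.
have := psip (real_scalar a *: v).
have := gc a; rewrite a0 a1 => /(_ isT).
move: fE; rewrite /edom /=.
case: (phi _) => // r; case: (psi _) => // s [fE].
(* [p] is finite here: [+oo] would violate the bound by [a * c], and [-oo] would violate
   [psi <= p]. *)
case: (p _) => [t| |//]; rewrite ?lee_fin//= => gt st _ _.
rewrite fE; nra.
Unshelve. all: by end_near. Qed.

Theorem theorem5p5 (R : realType) (F : scalars)
  (X : topologicalLmodType (scalar_field R F)) (hausX : hausdorff_space X)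
  (A : set X) (convA : convex_set A)
  (H : set (X -> \bar R)) (H_neq0 : H !=set0) (H_shift : closed_under_shifts H)
  (n : nat) (f : 'I_n.+1 -> X -> R) (xs : X) (Axs : A xs)
  (f_codiff : forall i, weakly_Hcodifferentiable H (f i) xs)
  (xs_min : local_min_on (feasible_set A f) (f ord0) xs)
  (H_add : closed_under_addition H)
  (H_dom : forall h, H h -> (edom h)° 0)
  (phi psi p : 'I_n.+1 -> X -> \bar R)
  (phipsi : forall i, weak_Hderivative H (f i) xs (phi i, psi i))
  (p_sup : forall i, Hsuperdifferential0 H (psi i) (p i))
  (sums_def : forall i dx, (phi i dx +? p i dx)%E)
  (g_sub : subhomogeneous (gfun f xs phi p)) :
  global_min_on [set a - xs | a in A] (gfun f xs phi p) 0.
Proof.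
have [g0 g_scale] := g_sub.
split; first by exists xs => //; rewrite subrr.
move=> _ [y Ay <-]; rewrite g0 leNgt; apply/negP => gy0.
set v := y - xs in gy0.
(* The value at [v] may be [-oo], so a real negative upper bound stands in for it. *)
have [c c0 gc] : exists2 c : R, c < 0 & (gfun f xs phi p v <= c%:E)%E.
  case: (gfun _ _ _ _ _) gy0 => [r| |]//; rewrite ?lte_fin => r0.
    by exists r.
  by exists (-1); [exact: ltrN10 | exact: leNye].
have domN : \forall z \near (0 : X),
    forall i, (edom (phi i) `&` edom (psi i)) z.
  by apply: filter_forall => i; have [] := phipsi i.
have /nbhs_ballP[r /= r0 domr] := @real_scale_cvg0 R F X v _ domN.
(* [d < r] keeps the segment up to [d v] in all the domains; [d < 1] keeps [a * d] in the range of
   subhomogeneity and convexity. *)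
pose d := Num.min (r / 2) 2^-1.
have [d0 d1 dr] : [/\ 0 < d, d < 1 & d < r].
  by rewrite /d; split; case: (ltP (r / 2) 2^-1) => ?; lra.
have domd i (a : R) : 0 <= a <= 1 ->
    (edom (phi i) `&` edom (psi i)) (real_scalar a *: (real_scalar d *: v)).
  move=> a01; rewrite scalerA -real_scalarM; apply: domr.
  rewrite /ball/= sub0r normrN ger0_norm; nra.
have gd (a : R) : 0 < a < 1 ->
    (gfun f xs phi p (real_scalar a *: (real_scalar d *: v))
      <= (a * (d * c))%:E)%E.
  move=> a01; rewrite scalerA -real_scalarM.
  apply: le_trans (g_scale _ _ _) _; first by nra.
  rewrite mulrA [leRHS]EFinM lee_pmul2l//= lte_fin; nra.
have dc0 : d * c < 0 by nra.
pose z (a : R) : X := xs + real_scalar a *: (real_scalar d *: v).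
have descent i e :
    (forall dx, (phi i dx + p i dx + e%:E <= gfun f xs phi p dx)%E) ->
    \forall a \near 0^'+, f i (z a) - f i xs + e < 0.
  move=> leg; have [_ psip _] := p_sup i.
  apply: weak_Hcodifferential_descent (phipsi i) psip (domd i) dc0 _ => a a01.
  exact: le_trans (leg _) (gd a a01).
have f0lt : \forall a \near 0^'+, f ord0 (z a) - f ord0 xs + 0 < 0.
  by apply: descent => dx; rewrite adde0; apply: ereal_sup_ubound; left.
(* With the offset [f_i(xs)] the increment collapses to [f_i (z a)], which gives feasibility;
   finitely many constraints share one range of [a]. *)
have fle : \forall a \near 0^'+, forall i : 'I_n,
    f (lift ord0 i) (z a) - f (lift ord0 i) xs + f (lift ord0 i) xs < 0.
  apply: filter_forall => i; apply: descent => dx.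
  by apply: ereal_sup_ubound; right; exists i.
have [_ xs_le] := xs_min.
have z_xs : z a @[a --> (0 : R)^'+] --> xs.
  apply: cvg_at_right_filter; rewrite -[X in _ --> X]addr0.
  apply: (@continuous2_cvg _ _ _ _ _ _ (fun=> xs) _ (fun y z => y + z)).
  - exact: (@add_continuous X (xs, 0)).
  - exact: cvg_cst.
  - exact: real_scale_cvg0.
near (0 : R)^'+ => a.
have a0 : 0 < a by near: a; exact: nbhs_right_gt.
have a1 : a < 1 by near: a; exact: nbhs_right_lt.
have fa0 : f ord0 (z a) - f ord0 xs + 0 < 0 by near: a.
have fai (i : 'I_n) :
    f (lift ord0 i) (z a) - f (lift ord0 i) xs + f (lift ord0 i) xs < 0.
  by move: i; near: a.
have xsa : feasible_set A f (z a) -> f ord0 xs <= f ord0 (z a).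
  by near: a; exact: (z_xs _ xs_le).
(* Feasibility of [z a] would give [f_0 xs <= f_0 (z a)], against the strict decrease [fa0]. *)
suff /xsa : feasible_set A f (z a) by lra.
split => [|i]; last by have := fai i; rewrite subrK => /ltW.
rewrite /z scalerA -real_scalarM; apply: convex_set_real_scale => //.
  by rewrite /v addrC subrK.
nra.
Unshelve. all: by end_near. Qed.
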